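(* Let $u$ be the solution of the Navier--Stokes equations on $\Omega\times[0,T]$ with $u\in L^\infty(0,T;H^{k+1}(\Omega))$, and let the finite element spaces $X_h,Q_h,V_h$, the trilinear form $b^*$, the observation operator $I_H$ (with $L^2$-stability constant $\breve C$), the Poincaré constant $C_P$ and the inf-sup constant $\beta^{LBB}$ be as described in the context. Let $0\le n<N_T$. Given $v_h^n,w_h^n\in V_h$, let $v_h^{n+1}\in V_h$ be the nudged step, satisfying for all $\phi_h\in V_h$ $$\Bigl(\frac{v_h^{n+1}-v_h^n}{\Delta t},\phi_h\Bigr)+b^*(v_h^n,v_h^n,\phi_h)+\chi\bigl(I_H(v_h^{n+1}-u(t_{n+1})),I_H\phi_h\bigr)+\nu(\nabla v_h^{n+1},\nabla\phi_h)=(f^{n+1},\phi_h),$$ and let $w_h^{n+1}\in V_h$ be the non-nudged step, satisfying for all $\phi_h\in V_h$ $$\Bigl(\frac{w_h^{n+1}-w_h^n}{\Delta t},\phi_h\Bigr)+b^*(w_h^n,w_h^n,\phi_h)+\nu(\nabla w_h^{n+1},\nabla\phi_h)=(f^{n+1},\phi_h).$$ Assume $v_h^n=w_h^n$. Then for any positive $H$ and $\chi$, $$|||v_h^{n+1}-u(t_{n+1})|||^2\le|||w_h^{n+1}-u(t_{n+1})|||^2+C\,\Delta t\,\chi\,\breve C^2\,(C_P^2+\Delta t\,\nu)\Bigl(1+\frac1{\beta^{LBB}}\Bigr)^2h^{2k}\,\|u\|_{\infty,k+1}^2,$$ where $C>0$ is a constant independent of $h$, $H$, $\Delta t$, $\nu$,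 $\chi$ and $u$.
   Context: Setting. $\Omega\subset\mathbb{R}^d$ ($d=2$ or $3$) is a bounded regular domain; $\nu>0$; $\Delta t>0$, $t_n=n\Delta t$, $n=0,\dots,N_T$, $T=N_T\Delta t$. $(u,p)$ is a sufficiently smooth solution of $u_t+u\cdot\nabla u-\nu\Delta u+\nabla p=f$, $\nabla\cdot u=0$ in $\Omega$, $u=0$ on $\partial\Omega$; $f^{n+1}=f(\cdot,t_{n+1})$. Norms. $(\cdot,\cdot)$, $\|\cdot\|$ are the $L^2(\Omega)$ inner product and norm; $\|\cdot\|_k$ is the $H^k(\Omega)$ norm; $\|u\|_{\infty,k}:=\sup_{0\le t\le T}\|u(\cdot,t)\|_k$; $|||\phi|||^2:=\|\phi\|^2+\Delta t\,\nu\|\nabla\phi\|^2$. Spaces. $X:=(H_0^1(\Omega))^d$, $Q:=L_0^2(\Omega)$, and $C_P$ is the Poincaré constant: $\|v\|\le C_P\|\nabla v\|$ for $v\in X$. $X_h\subset X$, $Q_h\subset Q$ are conforming finite element spaces on an edge-to-edge triangulation of $\Omega$ with maximum triangle diameter $h$, satisfying the discrete inf-sup condition $$\inf_{q_h\in Q_h}\sup_{v_h\in X_h}\frac{(q_h,\nabla\cdot v_h)}{\|q_h\|\,\|\nabla v_h\|}\ge\beta^{LBB}>0$$ with $\beta^{LBB}$ independent of $h$, and the approximation properties $\inf_{v_h\in X_h}\|\nabla(u-v_h)\|\le Ch^k\|u\|_{k+1}$ for $u\in H^{k+1}(\Omega)^d\cap X$ and $\inf_{q_h\in Q_h}\|q-q_h\|\le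 Ch^k\|q\|_k$ for $q\in H^k(\Omega)\cap Q$, with $C$ independent of $h$. The discretely divergence-free space is $V_h:=\{v_h\in X_h:(\nabla\cdot v_h,q_h)=0\ \ \forall q_h\in Q_h\}$. Trilinear form. $b^*(u,v,w):=\tfrac12(u\cdot\nabla v,w)-\tfrac12(u\cdot\nabla w,v)$. Observation operator. $H>0$ is the observation spacing and $I_H:X\to X_h$ is a linear operator satisfying $\|I_H(w)-w\|\le\hat C H\|\nabla w\|$ and $\|I_H(w)\|\le\breve C\|w\|$ for all $w$ in its domain, with $\hat C,\breve C$ independent of $H$. $\chi>0$ is the nudging parameter. *)

(* Defs.v *)
From HB Require Import structures.
From mathcomp Require Import all_boot all_order all_algebra.
From mathcomp Require Import all_classical all_reals all_analysis.

Set Implicit Arguments.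
Unset Strict Implicit.
Unset Printing Implicit Defensive.
Import Order.TTheory GRing.Theory Num.Theory.
Import numFieldNormedType.Exports.

Local Open Scope classical_set_scope.
Local Open Scope ring_scope.

(* The sigma-algebra on R^n generated by the coordinates, i.e. the Borel sets. *)
Section measurable_rV.
Context {R : realType} (n : nat).

Let coors : 'I_n -> 'rV[R]_n -> R := fun i x => x ord0 i.

Let rV_set0 : g_sigma_preimage coors set0.
Proof. exact: sigma_algebra0. Qed.

Let rV_setC A : g_sigma_preimage coors A -> g_sigma_preimage coors (~` A).
Proof. exact: sigma_algebraC. Qed.

Let rV_bigcup (F : (set 'rV[R]_n)^nat) :
  (forall i, g_sigma_preimage coors (F i)) ->
  g_sigma_preimage coors (\bigcup_i (F i)).
Proof. exact: sigma_algebra_bigcup. Qed.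

HB.instance Definition _ := @isMeasurable.Build default_measure_display
  'rV[R]_n (g_sigma_preimage coors) rV_set0 rV_setC rV_bigcup.

Lemma measurable_coor (i : 'I_n) :
  measurable_fun [set: 'rV[R]_n] (fun x : 'rV[R]_n => x ord0 i).
Proof.
move=> _ Y mY; rewrite setTI; apply: sub_sigma_algebra => /=.
rewrite -bigcup_seq/=; exists i => /=; first by rewrite mem_index_enum.
by exists Y => //; rewrite setTI.
Qed.

Lemma measurable_fun_rV d (T : measurableType d) (f : T -> 'rV[R]_n) :
  (forall i, measurable_fun [set: T] (fun x => f x ord0 i)) ->
  measurable_fun [set: T] f.
Proof.
move=> mf.
suff H : g_sigma_preimage (fun i => coors i \o f) `<=` measurable.
  move=> _ A mA; apply: H; rewrite g_sigma_preimage_comp.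
  by exists A.
apply: smallest_sub; first exact: sigma_algebra_measurable.
case: n f mf @coors => [|m] f mf coors'; first by rewrite big_ord0.
rewrite -bigcup_mkord_ord; apply: bigcup_sub => i Ii.
by move=> A [B mB <-]; exact: mf.
Qed.
End measurable_rV.

Section lebesgue_rV.
Context {R : realType}.

Definition snoc n (z : 'rV[R]_n * R) : 'rV[R]_n.+1 :=
  \row_i (if unlift ord_max i is Some j then z.1 ord0 j else z.2).

Lemma measurable_snoc n : measurable_fun [set: 'rV[R]_n * R] (@snoc n).
Proof.
apply: measurable_fun_rV => i; rewrite /snoc.
case: (unliftP ord_max i) => [j|] ->.
  apply: (eq_measurable_fun (fun z : 'rV[R]_n * R => z.1 ord0 j)).
    by move=> z _; rewrite mxE liftK.
  apply: (measurableT_comp (measurable_coor j)).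
  exact: measurable_fst.
apply: (eq_measurable_fun (fun z : 'rV[R]_n * R => z.2)).
  by move=> z _; rewrite mxE unlift_none.
exact: measurable_snd.
Qed.

Section snoc_measure.
Local Open Scope ereal_scope.
Variables (n : nat) (m : {measure set 'rV[R]_n -> \bar R}).

Definition snoc_measure : set 'rV[R]_n.+1 -> \bar R :=
  pushforward (m \x @lebesgue_measure R) (@snoc n).

Let snoc0 : snoc_measure set0 = 0.
Proof. by rewrite /snoc_measure /pushforward preimage_set0 measure0. Qed.

Let measurable_preimage_snoc A : measurable A -> measurable (@snoc n @^-1` A).
Proof. by move=> mA; rewrite -[X in measurable X]setTI; exact: measurable_snoc. Qed.

Let snoc_ge0 A : 0 <= snoc_measure A.
Proof. by rewrite /snoc_measure /pushforward; exact: measure_ge0. Qed.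

Let snoc_sigma_additive : semi_sigma_additive snoc_measure.
Proof.
move=> F mF tF mUF; rewrite /snoc_measure /pushforward preimage_bigcup.
apply: measure_semi_sigma_additive.
- by move=> i; exact: measurable_preimage_snoc.
- apply/trivIsetP => /= i j _ _ ij; rewrite -preimage_setI.
  by move/trivIsetP : tF => /(_ _ _ _ _ ij) ->//; rewrite preimage_set0.
- by rewrite -preimage_bigcup; exact: measurable_preimage_snoc.
Qed.

HB.instance Definition _ :=
  isMeasure.Build _ _ _ snoc_measure snoc0 snoc_ge0 snoc_sigma_additive.
End snoc_measure.

Fixpoint lebesgue_rV n : {measure set 'rV[R]_n -> \bar R} :=
  match n with
  | 0%N => \d_(0 : 'rV[R]_0)
  | n'.+1 => snoc_measure (lebesgue_rV n')
  end.

Lemma lebesgue_rV_box n (a b : 'I_n -> R) : (forall i, a i <= b i) ->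
  lebesgue_rV n [set x | forall i, x ord0 i \in `[a i, b i]] =
  (\prod_(i < n) (b i - a i))%:E.
Proof.
have mbox m (a' b' : 'I_m -> R) :
    measurable [set x : 'rV[R]_m | forall i, x ord0 i \in `[a' i, b' i]].
  have -> : [set x : 'rV[R]_m | forall i, x ord0 i \in `[a' i, b' i]] =
      \big[setI/setT]_(i < m) ((fun x : 'rV[R]_m => x ord0 i) @^-1` `[a' i, b' i]).
    rewrite -bigcap_seq; apply/seteqP; split => x /= hx i.
      by move=> _; exact: hx.
    by apply: hx; rewrite /= mem_index_enum.
  apply: bigsetI_measurable => i _; rewrite -[X in measurable X]setTI.
  by apply: measurable_coor => //; exact: measurable_itv.
elim: n a b => [|n IH] a b ab.
  rewrite big_ord0 /= /dirac indicE mem_set //; by case.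
rewrite big_ord_recr /= EFinM -IH; last by move=> i; exact: ab.
have -> : (b ord_max - a ord_max)%:E = lebesgue_measure `[a ord_max, b ord_max].
  rewrite lebesgue_measure_itv /= lte_fin.
  by have := ab ord_max; rewrite le_eqVlt => /orP[/eqP->|->] //;
    rewrite ltxx subrr.
rewrite -product_measure1E//; last exact: mbox.
rewrite /snoc_measure /pushforward /=; congr product_measure1.
apply/seteqP; split => -[v y] /=.
  move=> H; split.
    move=> i; have := H (lift ord_max i); rewrite mxE liftK /=.
    by have -> : lift ord_max i = widen_ord (leqnSn n) i
      by apply/val_inj; rewrite /= /bump leqNgt ltn_ord.
  by have := H ord_max; rewrite mxE unlift_none.
move=> [H1 H2] i; rewrite mxE; case: (unliftP ord_max i) => [j|] -> //=.
have -> : lift ord_max j = widen_ord (leqnSn n) j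
  by apply/val_inj; rewrite /= /bump leqNgt ltn_ord.
exact: H1.
Qed.

End lebesgue_rV.

Section domains.
Context {R : realType} {d : nat}.
Implicit Types (x y : 'rV[R]_d) (Omega : set 'rV[R]_d).

(* The library norm on 'rV[R]_d is the sup norm. *)
Definition enorm x : R := Num.sqrt (\sum_i x ord0 i ^+ 2).

Definition drop_coord (i : 'I_d) x : 'rV[R]_d :=
  \row_j (if j == i then 0 else x ord0 j).

(* Near each boundary point, in rotated coordinates x *m Q, Omega is the strict
   epigraph in direction i of a function g; the Lipschitz bound forces g not to
   depend on the i-th coordinate. *)
Definition lipschitz_boundary Omega : Prop :=
  forall x0, closure Omega x0 -> ~ Omega x0 ->
  exists (Q : 'M[R]_d) (i : 'I_d) (L r : R) (g : 'rV[R]_d -> R),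
    [/\ Q *m Q^T = 1%:M,
        0 < r,
        forall y z, `|g y - g z| <= L * enorm (drop_coord i (y - z)) &
        forall x, enorm (x - x0) < r ->
          (Omega x <-> g (x *m Q) < (x *m Q) ord0 i)].

(* "Regular" means Lipschitz: Omega is exactly triangulated by simplices below,
   so its boundary cannot be smooth. *)
Definition regular_domain Omega : Prop :=
  [/\ Omega !=set0, open Omega, connected Omega, bounded_set Omega &
      lipschitz_boundary Omega].

Definition simplex := 'I_d.+1 -> 'rV[R]_d.
Implicit Types s t : simplex.

(* Convex hull of those vertices of s that lie in A. *)
Definition face s (A : set 'rV[R]_d) : set 'rV[R]_d :=
  [set x | exists l : 'I_d.+1 -> R,
    [/\ forall i, 0 <= l i, \sum_i l i = 1, x = \sum_i l i *: s i &
        forall i, l i != 0 -> A (s i)]].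

Definition hull s : set 'rV[R]_d := face s setT.

Definition nondegenerate s : Prop :=
  (\matrix_(i < d, j < d) (s (lift ord0 i) - s ord0) ord0 j) \in unitmx.

Definition diameter (A : set 'rV[R]_d) : R :=
  sup [set r | exists x y, [/\ A x, A y & r = enorm (x - y)]].

Definition triangulation Omega (T : seq simplex) : Prop :=
  [/\ forall s, s \in T -> nondegenerate s,
      closure Omega = [set x | exists2 s, s \in T & hull s x] &
      forall s t, s \in T -> t \in T ->
        hull s `&` hull t = face s (range t)].

Definition mesh_size (T : seq simplex) : R :=
  \big[Num.max/0]_(s <- T) diameter (hull s).

Definition polynomial_function (p : 'rV[R]_d -> R) : Prop :=
  exists (m : nat) (c : {ffun 'I_d -> 'I_m} -> R),
    forall x, p x = \sum_a c a * \prod_i x ord0 i ^+ a i.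

Definition piecewise_polynomial (T : seq simplex) (f : 'rV[R]_d -> R) : Prop :=
  forall s, s \in T -> exists2 p, polynomial_function p &
    forall x, interior (hull s) x -> f x = p x.

End domains.

Definition finitely_spanned (R : realType) (V : lmodType R) (W : set V) : Prop :=
  exists (m : nat) (b : 'I_m -> V),
    W = [set w | exists c : 'I_m -> R, w = \sum_i c i *: b i].

Section sobolev.
Context {R : realType} {d : nat} (Omega : set 'rV[R]_d).
Let mu := @lebesgue_rV R d.

Definition inner (f g : 'rV[R]_d -> R) : R :=
  \int[mu]_(x in Omega) (f x * g x).

Definition L2 (f : 'rV[R]_d -> R) : Prop :=
  measurable_fun Omega f /\
  mu.-integrable Omega (fun x => (f x ^+ 2)%:E).

Definition L20 (f : 'rV[R]_d -> R) : Prop :=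
  L2 f /\ \int[mu]_(x in Omega) f x = 0.

Definition multi_index := 'I_d -> nat.
Definition index0 : multi_index := fun=> 0%N.
Definition index_at (i : 'I_d) (m : nat) : multi_index :=
  fun j => if j == i then m else 0%N.
Definition order (a : multi_index) : nat := (\sum_i a i)%N.

Definition pderiv (i : 'I_d) (f : 'rV[R]_d -> R) : 'rV[R]_d -> R :=
  fun x => 'D_(delta_mx ord0 i) f x.

Definition mderiv (a : multi_index) (f : 'rV[R]_d -> R) : 'rV[R]_d -> R :=
  foldr (fun i g => iter (a i) (pderiv i) g) f (enum 'I_d).

Definition smooth (f : 'rV[R]_d -> R) : Prop :=
  forall s : seq 'I_d, let g := foldr pderiv f s in
    continuous g /\ forall x i, derivable g x (delta_mx ord0 i).

Definition test_function (f : 'rV[R]_d -> R) : Prop :=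
  let supp := closure [set x | f x != 0] in
  [/\ smooth f, compact supp & supp `<=` Omega].

Definition weak_derivative (a : multi_index) (f g : 'rV[R]_d -> R) : Prop :=
  forall phi, test_function phi ->
    inner f (mderiv a phi) = (-1) ^+ order a * inner g phi.

(* A Sobolev function is carried together with its weak derivatives: u a stands
   for D^a u, and u index0 for u itself. The components of order beyond the
   regularity of u are unconstrained and unused. Linear combinations are
   componentwise. *)
Definition jet := multi_index -> 'rV[R]_d -> R.
Definition vjet := 'I_d -> jet.

Definition jet_of (phi : 'rV[R]_d -> R) : jet := fun a => mderiv a phi.

Definition sobolev (m : nat) (u : jet) : Prop :=
  forall a, (order a <= m)%N ->
    L2 (u a) /\ weak_derivative a (u index0) (u a).

Definition hnorm2 (m : nat) (u : jet) : R :=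
  \sum_(a : {ffun 'I_d -> 'I_m.+1} | (\sum_i a i <= m)%N)
    inner (u (fun i => a i : nat)) (u (fun i => a i : nat)).

Definition hnorm (m : nat) (u : jet) : R := Num.sqrt (hnorm2 m u).

Definition vhnorm (m : nat) (u : vjet) : R :=
  Num.sqrt (\sum_i hnorm2 m (u i)).

Definition H10 (u : jet) : Prop :=
  sobolev 1 u /\
  forall e, 0 < e -> exists2 phi, test_function phi & hnorm 1 (u - jet_of phi) < e.

Definition spaceX : set vjet := [set u | forall i, H10 (u i)].

Definition field := 'I_d -> 'rV[R]_d -> R.

Definition finner (F G : field) : R := \sum_i inner (F i) (G i).
Definition fnorm (F : field) : R := Num.sqrt (finner F F).
Definition L2norm (f : 'rV[R]_d -> R) : R := Num.sqrt (inner f f).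

Definition vval (u : vjet) : field := fun i => u i index0.
Definition partial (i : 'I_d) (u : jet) : 'rV[R]_d -> R := u (index_at i 1).

Definition vinner (u v : vjet) : R := finner (vval u) (vval v).
Definition vnorm (u : vjet) : R := fnorm (vval u).
Definition ginner (u v : vjet) : R :=
  \sum_i \sum_j inner (partial j (u i)) (partial j (v i)).
Definition gnorm (u : vjet) : R := Num.sqrt (ginner u u).

Definition divergence (u : vjet) : 'rV[R]_d -> R :=
  fun x => \sum_i partial i (u i) x.
Definition laplacian (u : vjet) : field :=
  fun i x => \sum_j u i (index_at j 2) x.
Definition advection (u v : vjet) : field :=
  fun i x => \sum_j u j index0 x * partial j (v i) x.

Definition bstar (u v w : vjet) : R :=
  1 / 2 * finner (advection u v) (vval w) -
  1 / 2 * finner (advection u w) (vval v).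

Definition triple_norm (nu dt : R) (u : vjet) : R :=
  Num.sqrt (vnorm u ^+ 2 + dt * nu * gnorm u ^+ 2).

(* Strong solution on [0, T]: the time derivative ut is the limit of difference
   quotients in L^2 (one-sided at the endpoints), and the equations hold almost
   everywhere in Omega at each time. *)
Definition NSE_solution (nu T : R) (f : R -> field) (u : R -> vjet)
    (p : R -> jet) : Prop :=
  exists ut : R -> field, forall t, t \in `[0, T] ->
  [/\ spaceX (u t) /\ (forall i, sobolev 2 (u t i)),
      sobolev 1 (p t),
      forall i, L2 (f t i) /\ L2 (ut t i),
      (fun s => fnorm (fun i x =>
          (u s i index0 x - u t i index0 x) / (s - t) - ut t i x))
        @ within `[0, T] (t^') --> 0 &
      {ae mu, forall x, Omega x ->
        divergence (u t) x = 0 /\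
        forall i, ut t i x + advection (u t) (u t) i x
                  - nu * laplacian (u t) i x + partial i (p t) x = f t i x}].

Definition norms_in_time (T : R) (m : nat) (u : R -> vjet) : set R :=
  [set r | exists2 t, t \in `[0, T] & r = vhnorm m (u t)].

Definition Linfty_H (T : R) (m : nat) (u : R -> vjet) : Prop :=
  (forall t, t \in `[0, T] -> forall i, sobolev m (u t i)) /\
  has_ubound (norms_in_time T m u).

Definition sup_hnorm (T : R) (m : nat) (u : R -> vjet) : R :=
  sup (norms_in_time T m u).

Definition velocity_space (Th : seq simplex) (Xh : set vjet) : Prop :=
  [/\ Xh `<=` spaceX, finitely_spanned Xh &
      forall v, Xh v -> forall i, piecewise_polynomial Th (vval v i)].

Definition pressure_space (Th : seq simplex) (Qh : set ('rV[R]_d -> R)) : Prop :=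
  [/\ Qh `<=` L20, finitely_spanned Qh &
      forall q, Qh q -> piecewise_polynomial Th q].

(* Extended reals, so that the infimum over an empty set is +oo. *)
Definition inf_sup (Xh : set vjet) (Qh : set ('rV[R]_d -> R)) (beta : R) : Prop :=
  let quotients q : set (\bar R) :=
    [set r | exists v, [/\ Xh v, gnorm v != 0 &
       r = (inner q (divergence v) / (L2norm q * gnorm v))%:E]] in
  (beta%:E <= ereal_inf [set s | exists q, [/\ Qh q, L2norm q != 0%R &
                                   s = ereal_sup (quotients q)]])%E.

Definition approximation_property (k : nat) (C h : R) (Xh : set vjet)
    (Qh : set ('rV[R]_d -> R)) : Prop :=
  (forall u : vjet, spaceX u -> (forall i, sobolev k.+1 (u i)) ->
     inf [set r | exists2 v, Xh v & r = gnorm (u - v)]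
       <= C * h ^+ k * vhnorm k.+1 u) /\
  (forall q : jet, sobolev k q -> L20 (q index0) ->
     inf [set r | exists2 qh, Qh qh & r = L2norm (q index0 - qh)]
       <= C * h ^+ k * hnorm k q).

Definition div_free (Xh : set vjet) (Qh : set ('rV[R]_d -> R)) : set vjet :=
  [set v | Xh v /\ forall q, Qh q -> inner (divergence v) q = 0].

Definition poincare_constant (CP : R) : Prop :=
  forall v, spaceX v -> vnorm v <= CP * gnorm v.

Definition observation_operator (Xh : set vjet) (H Chat Cbreve : R)
    (IH : vjet -> vjet) : Prop :=
  [/\ forall w, spaceX w -> Xh (IH w),
      forall (a : R) w1 w2, spaceX w1 -> spaceX w2 ->
        IH (a *: w1 + w2) = a *: IH w1 + IH w2,
      forall w, spaceX w -> vnorm (IH w - w) <= Chat * H * gnorm w &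
      forall w, spaceX w -> vnorm (IH w) <= Cbreve * vnorm w].

End sobolev.

(* Main.v *)
Require Import Defs.
From HB Require Import structures.
From mathcomp Require Import all_boot all_order all_algebra.
From mathcomp Require Import all_classical all_reals all_analysis.
Import Order.TTheory GRing.Theory Num.Theory.
Import numFieldNormedType.Exports.
From mathcomp Require Import measurable_realfun ring lra.
Local Open Scope classical_set_scope.
Local Open Scope ring_scope.

Set Implicit Arguments.
Unset Strict Implicit.
Unset Printing Implicit Defensive.

(** Both steps start from the same state, so the explicit convection terms and
    the forcing cancel in the difference of the two equations. With
    [a (x, y) = (x, y) + dt nu (grad x, grad y)], the form of the triple norm,
    what remains is [a (v - w, phi) = - dt chi (I_H (v - u), I_H phi)] for all
    discretely divergence-free [phi], where [v] and [w] are the nudged and the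
    unnudged step. Testing with [phi = v - ut], for a discrete [ut] such that
    [ut - u] is [a]-orthogonal to [v - w], makes the nudging term dissipative up
    to [dt chi / 2 |I_H (u - ut)|^2] ([nudging_estimate]). Stability of [I_H] and
    the Poincare inequality bound this by the gradient error of any discretely
    divergence-free approximation of [u].

    It remains to approximate [u] within the discretely divergence-free space.
    An approximation [z] in the velocity space is corrected by the least-gradient
    velocity with the same discrete divergence; the inf-sup condition bounds the
    correction through its Lagrange multiplier, at the cost of the factor
    [1 + d / beta] ([div_free_quasi_optimal]). The existence of that multiplier
    is the solvability of a symmetric, possibly degenerate, saddle point system
    ([saddle_point_solvable]). The approximation property then gives the power
    of [h].

    The forms above are integrals over [Omega]. Their bilinearity needs [Omega]
    measurable ([open_measurable_rV]) and square-integrability, and applying the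
    Poincare inequality and [I_H] to errors needs the Sobolev space with zero
    boundary values to be a linear subspace ([spaceX_subspace]). *)

(** * Borel sets and Lebesgue measure on row vectors *)

Section measure_facts.
Context {R : realType} {d : nat}.
Implicit Types (Omega : set 'rV[R]_d) (f g : 'rV[R]_d -> R).

Lemma measurable_rV_box (J : 'I_d -> interval R) :
  measurable [set x : 'rV[R]_d | forall i, x ord0 i \in J i].
Proof.
have -> : [set x : 'rV[R]_d | forall i, x ord0 i \in J i] =
    \big[setI/setT]_(i < d) ((fun x : 'rV[R]_d => x ord0 i) @^-1` [set` J i]).
  rewrite -bigcap_seq; apply/seteqP; split => x /= hx i.
    by move=> _; exact: hx.
  by apply: hx; rewrite /= mem_index_enum.
apply: bigsetI_measurable => i _; rewrite -[X in measurable X]setTI.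
by apply: measurable_coor => //; exact: measurable_itv.
Qed.

Lemma bounded_sub_cube Omega : bounded_set Omega ->
  exists2 M : R, 0 <= M & forall x, Omega x -> forall i, x ord0 i \in `[- M, M].
Proof.
move=> [M [_ HM]]; exists (`|M| + 1); first exact: addr_ge0.
move=> x Ox i; rewrite in_itv /= -ler_norml.
apply: le_trans (HM (`|M| + 1) _ x Ox); last first.
  by rewrite (le_lt_trans (ler_norm M))// ltrDl.
rewrite /Num.norm /= mx_normrE.
exact: (le_bigmax _ (fun ij : 'I_1 * 'I_d => `|x ij.1 ij.2|) (ord0, i)).
Qed.

(** The measurable sets are generated by the coordinates, so openness is
    exploited through cubes with rational centres and radii 1 / (N + 1): there
    are countably many of them, and every open set is a union of such cubes. *)
Lemma open_measurable_rV Omega : open Omega -> measurable Omega.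
Proof.
move=> oO.
pose box (z : 'rV[rat]_d * nat) := [set x : 'rV[R]_d | forall i,
  x ord0 i \in `](ratr (z.1 ord0 i) - z.2.+1%:R^-1), (ratr (z.1 ord0 i) + z.2.+1%:R^-1)[].
have -> : Omega = \bigcup_z (if `[< box z `<=` Omega >] then box z else set0).
  apply/seteqP; split => [x Ox|x [z _]]; last by case: asboolP => // /[apply].
  have /nbhs_ballP[e /= e0 xe] := open_nbhs_nbhs (conj oO Ox).
  have [N Ne] : exists N, N.+1%:R^-1 < e / 2.
    exists (Num.truncn (e / 2)^-1); rewrite invf_plt ?posrE ?divr_gt0//.
    exact: truncnS_gt.
  have N0 : 0 < (N.+1%:R^-1 : R) by rewrite invr_gt0.
  have [r rE] : exists r : R, r = N.+1%:R^-1 by exists N.+1%:R^-1.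
  rewrite -rE in Ne N0.
  have /choice[q qx] i : exists q : rat, ratr q \in
      `](x ord0 i - r), (x ord0 i + r)[.
    by apply: rat_in_itvoo; lra.
  exists (\row_i q i, N) => //; rewrite /box /= -rE.
  case: asboolP => [_ i|nb] /=.
    by have := qx i; rewrite mxE !in_itv /= => /andP[? ?]; apply/andP; split; lra.
  exfalso; apply: nb => y yb; apply: xe; split => // i j; rewrite ord1.
  have := yb j; have := qx j; rewrite /= mxE !in_itv /= => /andP[? ?] /andP[? ?].
  by rewrite /ball /= ltr_norml; apply/andP; split; lra.
apply: countable_bigcupT_measurable => // z; case: ifP => // _.
exact: measurable_rV_box.
Qed.

Lemma continuous_measurable_rV Omega f :
  open Omega -> continuous f -> measurable_fun Omega f.
Proof.
move=> oO /continuousP cf.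
apply: (measurability _ (RGenOpens.measurableE R)).
move=> _ [_ [a [b ->] <-]]; apply: open_measurable_rV; apply: openI => //.
exact/cf/interval_open.
Qed.

Lemma bounded_lebesgue_rV_fin Omega : open Omega -> bounded_set Omega ->
  (lebesgue_rV d Omega < +oo)%E.
Proof.
move=> oO /bounded_sub_cube[M M0 OM].
apply: (@le_lt_trans _ _ (lebesgue_rV d
    [set x : 'rV[R]_d | forall i, x ord0 i \in `[- M, M]])).
  apply: le_measure; rewrite ?inE//; first exact: open_measurable_rV.
  exact: measurable_rV_box.
rewrite (@lebesgue_rV_box R d (fun=> - M) (fun=> M)) ?ltry// => i.
by rewrite (le_trans _ M0)// oppr_le0.
Qed.

End measure_facts.

(** * Semi-inner products on linear subspaces *)

Section semi_inner.
Context {R : realType}.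

Definition linear_subspace (V : lmodType R) (D : set V) : Prop :=
  D 0 /\ forall (a : R) x y, D x -> D y -> D (a *: x + y).

(** Integral forms are bilinear only where the products are integrable, hence
    the domain [D] in the linearity clause; they vanish on functions that are
    null almost everywhere, hence no definiteness. *)
Definition semi_inner (V : lmodType R) (D : set V) (b : V -> V -> R) : Prop :=
  [/\ linear_subspace D,
      forall (a : R) x y z, D x -> D y -> D z ->
        b (a *: x + y) z = a * b x z + b y z,
      forall x y, b x y = b y x &
      forall x, 0 <= b x x].

Lemma linear_subspaceD (V : lmodType R) (D : set V) x y :
  linear_subspace D -> D x -> D y -> D (x + y).
Proof. by move=> [_ DL] Dx Dy; rewrite -[x]scale1r; exact: DL. Qed.

Lemma linear_subspaceZ (V : lmodType R) (D : set V) a x :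
  linear_subspace D -> D x -> D (a *: x).
Proof. by move=> [D0 DL] Dx; rewrite -[_ *: _]addr0; exact: DL. Qed.

Lemma linear_subspaceB (V : lmodType R) (D : set V) x y :
  linear_subspace D -> D x -> D y -> D (x - y).
Proof. by move=> [_ DL] Dx Dy; rewrite addrC -scaleN1r; exact: DL. Qed.

Lemma linear_subspace_sum (V : lmodType R) (D : set V) (I : finType)
    (P : pred I) (e : I -> V) :
  linear_subspace D -> (forall i, P i -> D (e i)) -> D (\sum_(i | P i) e i).
Proof.
move=> DL De; elim/big_ind: _ => //; first by case: DL.
by move=> x y; exact: linear_subspaceD.
Qed.

Lemma semi_inner_pullback (V W : lmodType R) (D : set V) (E : set W)
    (phi : W -> V) (b : V -> V -> R) :
  (forall (a : R) x y, E x -> E y -> phi (a *: x + y) = a *: phi x + phi y) ->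
  linear_subspace E -> (forall x, E x -> D (phi x)) -> semi_inner D b ->
  semi_inner E (fun x y => b (phi x) (phi y)).
Proof.
move=> phiL EL ED [DL bL bS b0]; split => // a x y z Ex Ey Ez.
by rewrite phiL// bL//; exact: ED.
Qed.

Lemma semi_inner_sum (V : lmodType R) (D : set V) (I : finType) (P : pred I)
    (b : I -> V -> V -> R) :
  linear_subspace D -> (forall i, P i -> semi_inner D (b i)) ->
  semi_inner D (fun x y => \sum_(i | P i) b i x y).
Proof.
move=> DL bi; split => //.
- move=> a x y z Dx Dy Dz; rewrite mulr_sumr -big_split /=.
  by apply: eq_bigr => i /bi[_ bL _ _]; rewrite bL.
- by move=> x y; apply: eq_bigr => i /bi[_ _ bS _].
- by move=> x; apply: sumr_ge0 => i /bi[_ _ _].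
Qed.

Lemma semi_inner_addZ (V : lmodType R) (D : set V) (b1 b2 : V -> V -> R) c :
  0 <= c -> semi_inner D b1 -> semi_inner D b2 ->
  semi_inner D (fun x y => b1 x y + c * b2 x y).
Proof.
move=> c0 [DL b1L b1S b10] [_ b2L b2S b20]; split => //.
- by move=> a x y z Dx Dy Dz; rewrite b1L// b2L//; ring.
- by move=> x y; rewrite b1S b2S.
- by move=> x; rewrite addr_ge0// mulr_ge0.
Qed.

Section theory.
Context (V : lmodType R) (D : set V) (b : V -> V -> R).
Hypothesis bP : semi_inner D b.

Let DL : linear_subspace D. Proof. by case: bP. Qed.
Let bS x y : b x y = b y x. Proof. by case: bP. Qed.
Let b0 x : 0 <= b x x. Proof. by case: bP. Qed.

Lemma semi_innerDl x y z : D x -> D y -> D z -> b (x + y) z = b x z + b y z.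
Proof.
by move=> Dx Dy Dz; case: bP => _ bL _ _; rewrite -{1}[x]scale1r bL// mul1r.
Qed.

Lemma semi_innerZl a x z : D x -> D z -> b (a *: x) z = a * b x z.
Proof.
move=> Dx Dz; case: bP => _ bL _ _; have D0 : D 0 by case: DL.
have e0 : b 0 z = 0.
  by have := bL 1 0 0 z D0 D0 Dz; rewrite scaler0 addr0; lra.
by rewrite -[a *: x]addr0 bL// e0 addr0.
Qed.

Lemma semi_innerBl x y z : D x -> D y -> D z -> b (x - y) z = b x z - b y z.
Proof.
move=> Dx Dy Dz; rewrite -scaleN1r semi_innerDl// ?semi_innerZl ?mulN1r//.
exact: linear_subspaceZ.
Qed.

Lemma semi_innerDr x y z : D x -> D y -> D z -> b z (x + y) = b z x + b z y.
Proof. by move=> *; rewrite bS semi_innerDl// !(bS z). Qed.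

Lemma semi_innerZr a x z : D x -> D z -> b z (a *: x) = a * b z x.
Proof. by move=> *; rewrite bS semi_innerZl// (bS z). Qed.

Lemma semi_innerBr x y z : D x -> D y -> D z -> b z (x - y) = b z x - b z y.
Proof. by move=> *; rewrite bS semi_innerBl// !(bS z). Qed.

Lemma semi_innerNN x : D x -> b (- x) (- x) = b x x.
Proof.
move=> Dx; have Dnx := linear_subspaceZ (-1) DL Dx.
by rewrite -scaleN1r semi_innerZl// semi_innerZr// !mulN1r opprK.
Qed.

Lemma semi_innerBB x y : D x -> D y ->
  b (x - y) (x - y) = b x x - 2 * b x y + b y y.
Proof.
move=> Dx Dy; have Dxy := linear_subspaceB DL Dx Dy.
by rewrite semi_innerBl// !semi_innerBr// (bS y x); ring.
Qed.

Lemma semi_inner_suml (I : finType) (e : I -> V) z :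
  (forall i, D (e i)) -> D z -> b (\sum_i e i) z = \sum_i b (e i) z.
Proof.
move=> De Dz.
apply: (@proj2 (D (\sum_i e i))).
elim/big_ind2: _ => [|x r y s [Dx <-] [Dy <-]|i _]; last by split.
  by split; [case: DL | rewrite -(scale0r 0) semi_innerZl ?mul0r//; case: DL].
by split; [exact: linear_subspaceD | rewrite semi_innerDl].
Qed.

Lemma semi_inner_lincombl (I : finType) (c : I -> R) (e : I -> V) z :
  (forall i, D (e i)) -> D z ->
  b (\sum_i c i *: e i) z = \sum_i c i * b (e i) z.
Proof.
move=> De Dz; rewrite semi_inner_suml// => [|i]; last exact: linear_subspaceZ.
by apply: eq_bigr => i _; exact: semi_innerZl.
Qed.

Lemma semi_inner_lincombr (I : finType) (c : I -> R) (e : I -> V) z :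
  (forall i, D (e i)) -> D z ->
  b z (\sum_i c i *: e i) = \sum_i c i * b z (e i).
Proof.
move=> De Dz; rewrite bS semi_inner_lincombl//.
by apply: eq_bigr => i _; rewrite bS.
Qed.

(** The discriminant argument, except that an isotropic [x] needs its own
    choice of [t], since the form may be degenerate. *)
Lemma cauchy_schwarz x y : D x -> D y -> b x y ^+ 2 <= b x x * b y y.
Proof.
move=> Dx Dy.
have q t : 0 <= t ^+ 2 * b x x + 2 * t * b x y + b y y.
  have := b0 (t *: x + y).
  rewrite semi_innerDl// ?semi_innerDr ?semi_innerZl ?semi_innerZr// ?(bS y x);
    try by [exact: linear_subspaceZ | exact: linear_subspaceD].
  - by congr (0 <= _); ring.
  - by apply: linear_subspaceD => //; exact: linear_subspaceZ.
have [bxx|bxx] := eqVneq (b x x) 0.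
  rewrite bxx mul0r; have [->|bxy] := eqVneq (b x y) 0; first by rewrite expr0n.
  (* at this t the affine function 2 t (b x y) + b y y is -1 *)
  have := q (- (b y y + 1) / (2 * b x y)).
  rewrite bxx mulr0 add0r.
  have -> : 2 * (- (b y y + 1) / (2 * b x y)) * b x y = - (b y y + 1) by field.
  by lra.
have bxx0 : 0 < b x x by rewrite lt_neqAle eq_sym bxx b0.
have := q (- b x y / b x x).
have -> : (- b x y / b x x) ^+ 2 * b x x + 2 * (- b x y / b x x) * b x y + b y y
  = (b x x * b y y - b x y ^+ 2) / b x x by field.
by rewrite pmulr_lge0 ?invr_gt0// subr_ge0.
Qed.

Lemma cauchy_schwarz_sqrt x y : D x -> D y ->
  b x y <= Num.sqrt (b x x) * Num.sqrt (b y y).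
Proof.
move=> Dx Dy; rewrite -sqrtrM//; apply: le_trans (ler_norm _) _.
by rewrite -sqrtr_sqr ler_sqrt ?mulr_ge0//; exact: cauchy_schwarz.
Qed.

Lemma semi_norm_triangle x y : D x -> D y ->
  Num.sqrt (b (x + y) (x + y)) <= Num.sqrt (b x x) + Num.sqrt (b y y).
Proof.
move=> Dx Dy; have Dxy := linear_subspaceD DL Dx Dy.
rewrite -(@ler_pXn2r _ 2)// ?nnegrE ?addr_ge0 ?sqrtr_ge0//.
rewrite sqr_sqrtr// sqrrD !sqr_sqrtr// semi_innerDl// !semi_innerDr// (bS y x).
by have := cauchy_schwarz_sqrt Dx Dy; lra.
Qed.

Lemma semi_normZ c x : D x ->
  Num.sqrt (b (c *: x) (c *: x)) = `|c| * Num.sqrt (b x x).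
Proof.
move=> Dx; have Dcx := linear_subspaceZ c DL Dx.
by rewrite semi_innerZl// semi_innerZr// mulrA -expr2 sqrtrM ?sqr_ge0// sqrtr_sqr.
Qed.

Lemma semi_inner0l z : D z -> b 0 z = 0.
Proof.
have D0 : D 0 by case: DL.
by move=> Dz; rewrite -(scale0r 0) semi_innerZl ?mul0r.
Qed.

Lemma semi_inner0 : b 0 0 = 0.
Proof. by apply: semi_inner0l; case: DL. Qed.

Lemma semi_norm_sum (I : finType) (e : I -> V) : (forall i, D (e i)) ->
  Num.sqrt (b (\sum_i e i) (\sum_i e i)) <= \sum_i Num.sqrt (b (e i) (e i)).
Proof.
move=> De; apply: (@proj2 (D (\sum_i e i))).
elim/big_ind2: _ => [|x r y s [Dx xr] [Dy ys]|i _]; last by split.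
  by rewrite semi_inner0 sqrtr0; split => //; case: DL.
split; first exact: linear_subspaceD.
by apply: le_trans (semi_norm_triangle Dx Dy) _; exact: lerD.
Qed.

End theory.
End semi_inner.

(** * The L2 inner product *)

Section L2_theory.
Context {R : realType} {d : nat} (Omega : set 'rV[R]_d).
Hypothesis mO : measurable Omega.
Let mu := @lebesgue_rV R d.
Implicit Types f g : 'rV[R]_d -> R.

Lemma L2_mul_integrable f g : L2 Omega f -> L2 Omega g ->
  mu.-integrable Omega (EFin \o (fun x => f x * g x)).
Proof.
move=> [mf f2] [mg g2].
(* |f g| <= f^2 + g^2 *)
apply: (le_integrable mO (g := (fun x => (f x ^+ 2)%:E) \+ (fun x => (g x ^+ 2)%:E))).
- by apply/measurable_EFinP; exact: measurable_funM.
- move=> x _; change (`|f x * g x|%:E <= `|f x ^+ 2 + g x ^+ 2|%:E)%E.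
  rewrite lee_fin [leRHS]ger0_norm; last first.
    by rewrite addr_ge0 ?sqr_ge0.
  rewrite ler_norml; have := sqr_ge0 (f x + g x); have := sqr_ge0 (f x - g x).
  have := sqr_ge0 (f x); have := sqr_ge0 (g x).
  by move=> ? ? ? ?; apply/andP; split; lra.
- exact: integrableD.
Qed.

Lemma L2_subspace : linear_subspace (L2 Omega).
Proof.
split.
  split; first exact: measurable_cst.
  apply: (eq_integrable mO (fun=> 0%E)); last exact: integrable0.
  by move=> x _ /=; rewrite expr0n.
move=> a f g [mf f2] [mg g2].
have maf : measurable_fun Omega (fun x => a * f x).
  by apply: measurable_funM => //; exact: measurable_cst.
have mh : measurable_fun Omega (a *: f + g) by exact: measurable_funD.
split => //.
pose k : 'rV[R]_d -> \bar R :=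
  (fun x => (2 * a ^+ 2)%:E * (f x ^+ 2)%:E)%E \+ (fun x => 2%:E * (g x ^+ 2)%:E)%E.
apply: (le_integrable mO (g := k)).
- by apply/measurable_EFinP; exact: measurable_funX.
- move=> x _; change (`|((a *: f + g) x) ^+ 2|%:E <=
    `|2 * a ^+ 2 * f x ^+ 2 + 2 * g x ^+ 2|%:E)%E.
  rewrite lee_fin !ger0_norm ?sqr_ge0//.
    rewrite -subr_ge0; have := sqr_ge0 (a * f x - g x); congr (0 <= _).
    change ((a *: f + g) x) with (a * f x + g x); ring.
  by have := sqr_ge0 (a * f x); have := sqr_ge0 (g x); rewrite exprMn; lra.
- by apply: integrableD => //; apply: integrableZl.
Qed.

Lemma inner_semi_inner : semi_inner (L2 Omega) (inner Omega).
Proof.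
split; first exact: L2_subspace.
- move=> a f g h Lf Lg Lh; rewrite /inner -RintegralZl ?L2_mul_integrable//.
  rewrite -RintegralD//; last exact: L2_mul_integrable; last first.
    have Laf : L2 Omega (a *: f) by exact: linear_subspaceZ L2_subspace _.
    have := L2_mul_integrable Laf Lh; apply: eq_integrable => // x _ /=.
    by rewrite /GRing.scale /= mulrA.
  by apply: eq_Rintegral => x _; rewrite /GRing.scale /= mulrDl mulrA.
- by move=> f g; apply: eq_Rintegral => x _; rewrite mulrC.
- by move=> f; apply: Rintegral_ge0 => x _; rewrite -expr2 sqr_ge0.
Qed.

End L2_theory.

(** * Linearity of the Sobolev spaces *)

Section sobolev_theory.
Context {R : realType} {d : nat} (Omega : set 'rV[R]_d).
Hypotheses (oO : open Omega) (bO : bounded_set Omega).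
Let mO : measurable Omega. Proof. exact: open_measurable_rV. Qed.
Implicit Types f g phi psi : 'rV[R]_d -> R.

(** A bounded domain lies in a compact cube, where a continuous function is
    bounded, and has finite measure. *)
Lemma L2_continuous f : continuous f -> L2 Omega f.
Proof.
move=> cf; split; first exact: continuous_measurable_rV.
apply: measurable_bounded_integrable => //.
- exact: bounded_lebesgue_rV_fin.
- by apply: measurable_funX; exact: continuous_measurable_rV.
have [M _ OM] := bounded_sub_cube bO.
pose K := [set x : 'rV[R]_d | forall i : 'I_d, `[- M, M]%classic (x ord0 i)].
have cK : compact K.
  exact: (@rV_compact R d (fun=> `[- M, M]%classic) (fun=> @segment_compact R _ _)).
have OK : Omega `<=` K by move=> x Ox i; exact: OM.
have cf2 : continuous (fun x => f x ^+ 2).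
  by move=> x; apply: continuousM; exact: cf.
have /compact_bounded [N [Nr HN]] :=
  continuous_compact (continuous_subspaceT cf2) cK.
by exists N; split => // m Nm x /OK Kx; apply: HN Nm _ _; exists x.
Qed.

Lemma order_index0 m : (Defs.order (@index0 d) <= m)%N.
Proof. by rewrite /Defs.order big1. Qed.

Lemma order_index_at i : (Defs.order (@index_at d i 1) <= 1)%N.
Proof.
rewrite /Defs.order (bigD1 i)//= /index_at eqxx big1 ?addn0// => j /negPf.
by move=> ->.
Qed.

(** Multi-index derivatives are iterated partial derivatives along a list of
    directions, the form in which [smooth] speaks of them. *)
Definition pderivs phi (s : seq 'I_d) := foldr (@pderiv R d) phi s.

Lemma mderivE a phi :
  mderiv a phi = pderivs phi (flatten [seq nseq (a i) i | i <- enum 'I_d]).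
Proof.
rewrite /mderiv /pderivs; elim: (enum 'I_d) => //= i s ->.
by rewrite foldr_cat; elim: (a i) => //= m ->.
Qed.

Lemma pderivs_linear (c : R) phi psi s : smooth phi -> smooth psi ->
  pderivs (c *: phi + psi) s = c *: pderivs phi s + pderivs psi s.
Proof.
move=> sphi spsi; elim: s => //= i s IH; rewrite -/(pderivs _ _) IH.
apply/funext => x; rewrite /pderiv deriveD//.
- by rewrite deriveZ//; apply: (sphi s).2.
- by apply: derivableZ; apply: (sphi s).2.
- by apply: (spsi s).2.
Qed.

Lemma mderiv_linear a (c : R) phi psi : smooth phi -> smooth psi ->
  mderiv a (c *: phi + psi) = c *: mderiv a phi + mderiv a psi.
Proof. by move=> *; rewrite !mderivE pderivs_linear. Qed.

Lemma smooth_linear (c : R) phi psi :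
  smooth phi -> smooth psi -> smooth (c *: phi + psi).
Proof.
move=> sphi spsi s /=; rewrite -/(pderivs _ _) pderivs_linear//; split => x.
  apply: continuousD; last exact: (spsi s).1.
  by apply: continuousZr; exact: (sphi s).1.
move=> i; apply: derivableD; last exact: (spsi s).2.
by apply: derivableZ; exact: (sphi s).2.
Qed.

Lemma test_function_linear (c : R) phi psi :
  test_function Omega phi -> test_function Omega psi ->
  test_function Omega (c *: phi + psi).
Proof.
move=> [sphi cphi phiO] [spsi cpsi psiO].
have supp : closure [set x | (c *: phi + psi) x != 0] `<=`
    closure [set x | phi x != 0] `|` closure [set x | psi x != 0].
  rewrite -closureU; apply: closureS => x /=; apply: contra_neqP => /not_orP[].
  move=> /negP/negPn/eqP phi0 /negP/negPn/eqP psi0.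
  by change (c * phi x + psi x = 0); rewrite phi0 psi0 mulr0 addr0.
split; first exact: smooth_linear.
  apply: subclosed_compact supp; first exact: closed_closure.
  exact: compactU.
by move=> x /supp[/phiO|/psiO].
Qed.

Lemma L2_mderiv a phi : test_function Omega phi -> L2 Omega (mderiv a phi).
Proof.
by move=> [sphi _ _]; apply: L2_continuous; rewrite mderivE; exact: (sphi _).1.
Qed.

Lemma L2_test_function phi : test_function Omega phi -> L2 Omega phi.
Proof. by move=> [sphi _ _]; apply: L2_continuous; case: (sphi [::]). Qed.

(** The integrals in [weak_derivative] are additive because test functions and
    their derivatives are themselves square-integrable. *)
Lemma sobolev_subspace m : linear_subspace (@sobolev R d Omega m).
Proof.
have I := inner_semi_inner mO; have L := L2_subspace mO.
split => [a am|c u v su sv a am].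
  have L0 : L2 Omega (0 : 'rV[R]_d -> R) by case: L.
  split => // phi tphi; rewrite !(semi_inner0l I) ?mulr0//.
    exact: L2_test_function.
  exact: L2_mderiv.
have [L1 w1] := su a am; have [L2 w2] := sv a am.
have [Lu _] := su (@index0 d) (order_index0 m).
have [Lv _] := sv (@index0 d) (order_index0 m).
split; first exact: L.2.
move=> phi tphi; have Lp := L2_mderiv a tphi.
have Lp0 := L2_test_function tphi.
change (inner Omega (c *: u index0 + v index0) (mderiv a phi) =
  (-1) ^+ Defs.order a * inner Omega (c *: u a + v a) phi).
have [_ bL _ _] := I; rewrite !bL//.
by rewrite w1// w2//; ring.
Qed.
End sobolev_theory.

Section spaceX_theory.
Context {R : realType} {d : nat} (Omega : set 'rV[R]_d).
Hypotheses (oO : open Omega) (bO : bounded_set Omega).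
Let mO : measurable Omega. Proof. exact: open_measurable_rV. Qed.
Let I := inner_semi_inner mO.

Definition L2_jet (m : nat) : set (@jet R d) :=
  [set u | forall a, (Defs.order a <= m)%N -> L2 Omega (u a)].

Lemma L2_jet_subspace m : linear_subspace (L2_jet m).
Proof.
have [L0 LL] := L2_subspace mO; split => [a _|c u v Lu Lv a am].
  exact: L0.
by apply: (LL c (u a) (v a)); [exact: Lu | exact: Lv].
Qed.

Lemma hnorm2_semi_inner m : semi_inner (L2_jet m)
  (fun u v => \sum_(a : {ffun 'I_d -> 'I_m.+1} | (\sum_i a i <= m)%N)
    inner Omega (u (fun i => a i : nat)) (v (fun i => a i : nat))).
Proof.
apply: semi_inner_sum => [|a am]; first exact: L2_jet_subspace.
apply: semi_inner_pullback I => //; first exact: L2_jet_subspace.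
by move=> u; exact.
Qed.

Lemma jet_of_linear (c : R) (phi psi : 'rV[R]_d -> R) : smooth phi -> smooth psi ->
  jet_of (c *: phi + psi) = c *: jet_of phi + jet_of psi.
Proof. by move=> sphi spsi; apply/funext => a; exact: mderiv_linear. Qed.

Lemma pderivs0 s : pderivs (0 : 'rV[R]_d -> R) s = 0.
Proof.
elim: s => //= i s IH; rewrite -/(pderivs _ _) IH; apply/funext => x.
exact: derive_cst.
Qed.

Lemma jet_of0 : jet_of (0 : 'rV[R]_d -> R) = 0.
Proof. by apply/funext => a; rewrite /jet_of mderivE pderivs0. Qed.

Lemma test_function0 : test_function Omega (0 : 'rV[R]_d -> R).
Proof.
rewrite /test_function.
have -> : [set x | (0 : 'rV[R]_d -> R) x != 0] = set0.
  by apply/seteqP; split => // x /=; rewrite eqxx.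
rewrite closure0; split => //; last exact: compact0.
move=> s; rewrite -/(pderivs _ _) pderivs0; split; first exact: cst_continuous.
by move=> x i; exact: derivable_cst.
Qed.

(** If [phi] and [psi] approximate [u] and [v] within [e / (|c| + 1)], then
    [c *: phi + psi] approximates [c *: u + v] within [e], by the triangle
    inequality for the Sobolev norm. *)
Lemma H10_subspace : linear_subspace (@H10 R d Omega).
Proof.
have S := sobolev_subspace oO bO 1; have B := hnorm2_semi_inner 1.
have SL u : sobolev Omega 1 u -> L2_jet 1 u by move=> su a /su[].
have TL phi : test_function Omega phi -> L2_jet 1 (jet_of phi).
  by move=> tphi a _; exact: L2_mderiv.
have LS := L2_jet_subspace 1.
split.
  split; first by case: S.
  move=> e e0; exists 0; first exact: test_function0.
  by rewrite jet_of0 subr0 /hnorm /hnorm2 (semi_inner0 B) sqrtr0.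
move=> c u v [su du] [sv dv]; split; first exact: S.2.
move=> e e0.
have c0 : 0 < `|c| + 1 by rewrite ltr_wpDl.
have e'0 : 0 < e / (`|c| + 1) by rewrite divr_gt0.
have [phi tphi hphi] := du _ e'0; have [psi tpsi hpsi] := dv _ e'0.
exists (c *: phi + psi); first exact: test_function_linear.
have [[sphi _ _] [spsi _ _]] := (tphi, tpsi).
rewrite jet_of_linear//.
have -> : c *: u + v - (c *: jet_of phi + jet_of psi) =
    c *: (u - jet_of phi) + (v - jet_of psi).
  by rewrite scalerBr opprD addrACA.
have Du : L2_jet 1 (u - jet_of phi) by apply: (linear_subspaceB LS); auto.
have Dv : L2_jet 1 (v - jet_of psi) by apply: (linear_subspaceB LS); auto.
have := semi_norm_triangle B (linear_subspaceZ c LS Du) Dv.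
rewrite (semi_normZ B c Du) => /le_lt_trans; apply.
have -> : e = `|c| * (e / (`|c| + 1)) + e / (`|c| + 1).
  by field; rewrite gt_eqF.
by rewrite ler_ltD// ler_wpM2l// ltW.
Qed.

Lemma spaceX_subspace : linear_subspace (@spaceX R d Omega).
Proof.
have [H0 HL] := H10_subspace; split => [i|c u v Xu Xv i]; first exact: H0.
exact: (HL c (u i) (v i)).
Qed.

Definition L2_vjet : set (@vjet R d) := [set u | forall i, L2_jet 1 (u i)].

Lemma L2_vjet_subspace : linear_subspace L2_vjet.
Proof.
have [H0 HL] := L2_jet_subspace 1; split => [i|c u v Xu Xv i]; first exact: H0.
exact: (HL c (u i) (v i)).
Qed.

Lemma spaceX_L2_vjet : @spaceX R d Omega `<=` L2_vjet.
Proof. by move=> u Xu i a a1; have [/(_ a a1)[]] := Xu i. Qed.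

(** Both forms are finite sums of pullbacks of the scalar L2 product. *)
Lemma vinner_semi_inner : semi_inner L2_vjet (vinner Omega).
Proof.
apply: semi_inner_sum => [|i _]; first exact: L2_vjet_subspace.
apply: (@semi_inner_pullback _ _ _ _ _ (fun u : vjet => u i index0)) I => //.
  exact: L2_vjet_subspace.
by move=> u; apply; exact: order_index0.
Qed.

Lemma ginner_semi_inner : semi_inner L2_vjet (ginner Omega).
Proof.
apply: semi_inner_sum => [|i _]; first exact: L2_vjet_subspace.
apply: semi_inner_sum => [|j _]; first exact: L2_vjet_subspace.
apply: (@semi_inner_pullback _ _ _ _ _ (fun u : vjet => partial j (u i))) I => //.
  exact: L2_vjet_subspace.
by move=> u; apply; exact: order_index_at.
Qed.

Lemma divergence_linear (c : R) (u v : @vjet R d) :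
  divergence (c *: u + v) = c *: divergence u + divergence v.
Proof.
apply/funext => x; rewrite /divergence.
change (\sum_i partial i ((c *: u + v) i) x =
  c * (\sum_i partial i (u i) x) + \sum_i partial i (v i) x).
by rewrite mulr_sumr -big_split.
Qed.

Lemma divergence0 : divergence (0 : @vjet R d) = 0.
Proof. by apply/funext => x; rewrite /divergence big1. Qed.

Lemma divergence_lincomb (K : finType) (c : K -> R) (e : K -> @vjet R d) :
  divergence (\sum_i c i *: e i) = \sum_i c i *: divergence (e i).
Proof.
elim/big_rec2: _ => [|i f u _ <-]; first exact: divergence0.
exact: divergence_linear.
Qed.

Lemma L2_divergence u : L2_vjet u -> L2 Omega (divergence u).
Proof.
move=> Lu; have -> : divergence u = \sum_i partial i (u i).
  by apply/funext => x; rewrite fct_sumE.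
apply: linear_subspace_sum => [|i _]; first exact: L2_subspace.
by apply: Lu; exact: order_index_at.
Qed.

(** The triangle inequality over the [d] diagonal derivatives, each of them
    bounded by the full gradient. *)
Lemma L2norm_divergence_le u : L2_vjet u ->
  L2norm Omega (divergence u) <= d%:R * Defs.gnorm Omega u.
Proof.
move=> Lu; have -> : divergence u = \sum_i partial i (u i).
  by apply/funext => x; rewrite fct_sumE.
have Lp i : L2 Omega (partial i (u i)) by apply: Lu; exact: order_index_at.
apply: le_trans (semi_norm_sum I Lp) _.
have -> : d%:R * Defs.gnorm Omega u = \sum_(i < d) Defs.gnorm Omega u.
  by rewrite sumr_const card_ord mulr_natl.
apply: ler_sum => i _; rewrite /Defs.gnorm /ginner ler_sqrt; last first.
  by apply: sumr_ge0 => j _; apply: sumr_ge0 => l _; case: I.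
have i0 j l : 0 <= inner Omega (partial l (u j)) (partial l (u j)) by case: I.
rewrite (bigD1 i)//= (bigD1 i)//= -addrA lerDl addr_ge0//; first exact: sumr_ge0.
by apply: sumr_ge0 => j _; exact: sumr_ge0.
Qed.

End spaceX_theory.

(** * Nudging and discrete saddle points for abstract forms *)

Section abstract_forms.
Context {R : realType} (V : lmodType R) (D : set V).

(** The minimiser of the [a]-norm on the line [y + c *: x] is orthogonal to its
    direction. When [x] is isotropic, Cauchy-Schwarz already gives
    orthogonality, and [c = 0] works. *)
Lemma orthogonal_shift (a : V -> V -> R) (x y : V) :
  semi_inner D a -> D x -> D y ->
  exists c, a x (y + c *: x) = 0 /\
            a (y + c *: x) (y + c *: x) <= a y y.
Proof.
move=> aP Dx Dy; have [DL _ aS a0] := aP.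
have Dcx c : D (c *: x) by exact: linear_subspaceZ.
have axE c : a x (y + c *: x) = a x y + c * a x x.
  by rewrite (semi_innerDr aP)// (semi_innerZr aP).
have aE c : a (y + c *: x) (y + c *: x) = a y y + c * a x y + c * (a x y + c * a x x).
  rewrite (semi_innerDl aP)//; last exact: linear_subspaceD.
  by rewrite (semi_innerZl aP) ?axE ?(semi_innerDr aP) ?(semi_innerZr aP) ?(aS y x)//;
    exact: linear_subspaceD.
have [axx|axx] := eqVneq (a x x) 0.
  exists 0; rewrite axE aE axx; have := cauchy_schwarz aP Dx Dy.
  rewrite axx mul0r => axy.
  have /eqP : a x y ^+ 2 == 0 by rewrite eq_le axy sqr_ge0.
  by move=> /eqP; rewrite sqrf_eq0 => /eqP ->; split; lra.
exists (- a x y / a x x); rewrite axE aE.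
have e0 : a x y + - a x y / a x x * a x x = 0 by field.
split => //; rewrite e0 mulr0 addr0 gerDl.
have -> : - a x y / a x x * a x y = - (a x y ^+ 2 / a x x) by field.
by rewrite oppr_le0 divr_ge0 ?sqr_ge0.
Qed.

(** Energy comparison of the two steps. With [x = v - u], expanding [a] at
    [w - u = x - (v - w)] leaves the cross term [2 * a (v - w) x]. Replace [z]
    by the point [ut] of the line [z + c *: (v - w)] for which [ut - u] is
    [a]-orthogonal to [v - w]: the cross term becomes [2 * a (v - w) (v - ut)],
    which the error equation tested with [v - ut] turns into
    [- 2 * kappa * s x x + 2 * kappa * s x (ut - u)]. Young's inequality absorbs
    the mixed term into the dissipative one and leaves
    [kappa / 2 * s (ut - u) (ut - u)], bounded by the [a]-norm of [ut - u] and
    so by that of [u - z]. The prefactor [kappa] survives only because of the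
    orthogonality: a plain Young bound on [a (v - w) (z - u)] would lose it. *)
Lemma nudging_estimate (a s : V -> V -> R) (kappa L : R) (W : set V) (u v w z : V) :
  semi_inner D a -> semi_inner D s -> 0 <= kappa -> 0 <= L ->
  (forall x, D x -> s x x <= L * a x x) ->
  linear_subspace W -> W `<=` D -> D u -> W v -> W w -> W z ->
  (forall phi, W phi -> a (v - w) phi + kappa * s (v - u) phi = 0) ->
  a (v - u) (v - u) <= a (w - u) (w - u) + kappa / 2 * L * a (u - z) (u - z).
Proof.
move=> aP sP k0 L0 sL WL WD Du Wv Ww Wz vw.
have [DL _ aS a0] := aP; have [_ _ sS s0] := sP.
have Wvw : W (v - w) by exact: linear_subspaceB.
have DB x y : D x -> D y -> D (x - y) by exact: linear_subspaceB.
have Dvw : D (v - w) by exact: WD.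
have Dzu : D (z - u) by apply: DB => //; exact: WD.
have [c [orth mini]] := orthogonal_shift aP Dvw Dzu.
pose ut := z + c *: (v - w).
have Wut : W ut by apply: linear_subspaceD => //; exact: linear_subspaceZ.
have utE : z - u + c *: (v - w) = ut - u by rewrite /ut addrAC.
rewrite utE in orth mini.
have Dvu : D (v - u) by apply: DB => //; exact: WD.
have Dutu : D (ut - u) by apply: DB => //; exact: WD.
have Dvut : D (v - ut) by apply: DB; exact: WD.
have e1 : a (v - w) (v - u) = - (kappa * (s (v - u) (v - u) - s (v - u) (ut - u))).
  have vuE : v - u = v - ut + (ut - u) by rewrite addrA subrK.
  rewrite {1}vuE (semi_innerDr aP)// orth addr0.
  have /vw : W (v - ut) by exact: linear_subspaceB.
  have -> : v - ut = v - u - (ut - u) by rewrite opprB addrA subrK.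
  by rewrite (semi_innerBr sP)//; lra.
have e2 : a (w - u) (w - u) =
    a (v - u) (v - u) - 2 * a (v - w) (v - u) + a (v - w) (v - w).
  have -> : w - u = v - u - (v - w) by rewrite opprB [RHS]addrC addrA subrK.
  by rewrite (semi_innerBB aP Dvu Dvw) (aS (v - u) (v - w)).
(* Young's inequality, from s (2 x - y) (2 x - y) >= 0 *)
have e3 : 2 * s (v - u) (ut - u) <= 2 * s (v - u) (v - u) + s (ut - u) (ut - u) / 2.
  have := s0 (2 *: (v - u) - (ut - u)).
  have D2 : D (2 *: (v - u)) by exact: linear_subspaceZ.
  rewrite (semi_innerBB sP D2 Dutu) !(semi_innerZl sP)// (semi_innerZr sP)//.
  by lra.
have e4 : s (ut - u) (ut - u) <= L * a (u - z) (u - z).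
  apply: le_trans (sL _ Dutu) _; rewrite ler_wpM2l// (le_trans mini)//.
  by rewrite -(opprB z u) (semi_innerNN aP).
have := ler_wpM2l k0 e3; have := ler_wpM2l k0 e4; have := a0 (v - w).
by rewrite e2 e1; lra.
Qed.

(** Solvability of a symmetric system amounts to the right-hand side being
    orthogonal to the kernel. If [(w1, w2)] is in the kernel of the saddle
    point matrix, then [w1] is isotropic for [A], hence [A w1 = 0] by
    Cauchy-Schwarz, hence [B w2 = 0], and the right-hand side [(0, c B)]
    vanishes on it. As [A] may be singular, the spanning families from which
    [A] and [B] are computed need not be bases. *)
Lemma saddle_point_solvable m p (A : 'M[R]_m) (B : 'M[R]_(m, p)) (c : 'rV[R]_m) :
  A^T = A -> (forall x : 'rV[R]_m, 0 <= (x *m A *m x^T) ord0 ord0) ->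
  exists (r : 'rV[R]_m) (y : 'rV[R]_p),
    r *m A = y *m B^T /\ r *m B = c *m B.
Proof.
move=> Asym Apsd.
pose K : 'M[R]_(m + p) := block_mx A B B^T 0.
pose t : 'rV[R]_(m + p) := row_mx 0 (c *m B).
suff /submxP[ry tE] : (t <= K)%MS.
  exists (lsubmx ry), (- rsubmx ry).
  move: tE; rewrite /t /K -{1}[ry]hsubmxK mul_row_block mulmx0 addr0.
  move=> /eq_row_mx[e1 e2]; split => //.
  by rewrite mulNmx; apply/eqP; rewrite -addr_eq0 -e1.
pose b (x y : 'rV[R]_m) := (x *m A *m y^T) ord0 ord0.
have bP : semi_inner setT b.
  split => //.
  - by move=> a x y z _ _ _; rewrite /b !mulmxDl -!scalemxAl !mxE.
  - move=> x y; rewrite /b -[x *m A *m y^T]trmxK mxE !trmx_mul trmxK Asym.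
    by rewrite mulmxA.
rewrite submxE; apply/eqP/matrixP => i j; rewrite ord1 {i}.
pose w := col j (cokermx K).
have Kw : K *m w = 0 by rewrite /w colE mulmxA mulmx_coker mul0mx.
move: Kw; rewrite /K -[w]vsubmxK mul_block_col mul0mx addr0 -[0]vsubmxK.
move=> /eq_col_mx; rewrite !linear0 => -[e1 e2].
have Aw0 : A *m usubmx w = 0.
  have bw0 : b (usubmx w)^T (usubmx w)^T = 0.
    rewrite /b trmxK -mulmxA; have -> : A *m usubmx w = - (B *m dsubmx w).
      by apply/eqP; rewrite -addr_eq0 e1.
    by rewrite mulmxN mulmxA -[B]trmxK -trmx_mul e2 trmx0 mul0mx oppr0 mxE.
  apply/matrixP => i k; rewrite ord1 [RHS]mxE.
  have := cauchy_schwarz bP (I : setT (delta_mx 0 i)) (I : setT (usubmx w)^T).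
  rewrite bw0 mulr0 /b trmxK -mulmxA -rowE mxE => h.
  by apply/eqP; rewrite -sqrf_eq0 eq_le h sqr_ge0.
have -> : (t *m cokermx K) ord0 j = (t *m w) ord0 ord0.
  have -> : t *m w = col j (t *m cokermx K) by rewrite /w !colE mulmxA.
  by rewrite [RHS]mxE.
rewrite /t -[w]vsubmxK mul_row_col mul0mx add0r -mulmxA.
have -> : B *m dsubmx w = 0 by move: e1; rewrite Aw0 add0r.
by rewrite mulmx0 !mxE.
Qed.

(** The element [sum_i r i *: e i] has the same constraint values as the one with
    coefficients [c], and [y] is the Lagrange multiplier that witnesses its
    [g]-minimality. *)
Lemma discrete_lagrange (g : V -> V -> R) m p (e : 'I_m -> V)
    (B : 'I_m -> 'I_p -> R) (c : 'I_m -> R) :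
  semi_inner D g -> (forall i, D (e i)) ->
  exists (r : 'I_m -> R) (y : 'I_p -> R),
    (forall k, g (\sum_i r i *: e i) (e k) = \sum_j y j * B k j) /\
    (forall j, \sum_i r i * B i j = \sum_i c i * B i j).
Proof.
move=> gP De; have [DL _ gS g0] := gP.
have DZ (a : R) i : D (a *: e i) by exact: linear_subspaceZ.
pose A := \matrix_(i, k) g (e i) (e k).
have gE (x : 'I_m -> R) k : g (\sum_i x i *: e i) (e k) = \sum_i x i * g (e i) (e k).
  rewrite (semi_inner_suml gP)//; apply: eq_bigr => i _.
  by rewrite (semi_innerZl gP).
have [||r [y [rA rB]]] :=
  @saddle_point_solvable m p A (\matrix_(i, j) B i j) (\row_i c i).
- by apply/matrixP => i k; rewrite !mxE gS.
- move=> x.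
  suff -> : (x *m A *m x^T) ord0 ord0 =
    g (\sum_i x ord0 i *: e i) (\sum_i x ord0 i *: e i) by exact: g0.
  rewrite (semi_inner_suml gP)//; last exact: linear_subspace_sum.
  rewrite -mulmxA mxE; apply: eq_bigr => i _.
  rewrite (semi_innerZl gP)//; last exact: linear_subspace_sum.
  congr (_ * _); rewrite gS gE mxE; apply: eq_bigr => k _.
  by rewrite !mxE mulrC gS.
exists (r ord0), (y ord0); split => [k|j].
  rewrite gE; have /matrixP/(_ ord0 k) := rA; rewrite !mxE.
  under eq_bigr do rewrite mxE.
  by move=> ->; apply: eq_bigr => j _; rewrite !mxE.
have /matrixP/(_ ord0 j) := rB; rewrite !mxE.
under eq_bigr do rewrite mxE.
by move=> ->; apply: eq_bigr => i _; rewrite !mxE.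
Qed.

End abstract_forms.

(** * Discretely divergence-free approximation *)

Section discrete_spaces.
Context {R : realType} {d : nat} (Omega : set 'rV[R]_d).
Hypothesis oO : open Omega.
Let mu := @lebesgue_rV R d.
Let mO : measurable Omega. Proof. exact: open_measurable_rV. Qed.
Let I := inner_semi_inner mO.
Let G := ginner_semi_inner oO.

Lemma finitely_spanned_subspace (V : lmodType R) (W : set V) :
  finitely_spanned W -> linear_subspace W.
Proof.
move=> [m [b ->]]; split => [|a x y [c ->] [c' ->]].
  by exists (fun=> 0); rewrite big1// => i _; rewrite scale0r.
exists (fun i => a * c i + c' i); rewrite scaler_sumr -big_split.
by apply: eq_bigr => i _; rewrite scalerA scalerDl.
Qed.

Lemma inner_ae_eq0 (q f : 'rV[R]_d -> R) : L2 Omega q -> L2 Omega f ->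
  {ae mu, forall x, Omega x -> f x = 0} -> inner Omega q f = 0.
Proof.
move=> Lq Lf f0; rewrite /inner /Rintegral.
rewrite (ae_eq_integral (fun=> 0%E)) ?integral0//.
- by apply: (measurable_int mu); exact: L2_mul_integrable.
- by apply: filterS f0 => x fx Ox; rewrite /= fx// mulr0.
Qed.

(** Remove from [z] the velocity [r] of least gradient norm with the same
    discrete divergence. Its Lagrange multiplier [qs] represents
    [v |-> (grad r, grad v)] as [v |-> (qs, div v)], so that the inf-sup
    condition gives [beta * |qs| <= |grad r|]. As [div u = 0],
    [|grad r|^2 = (qs, div z) = - (qs, div (u - z)) <= |qs| * d * |grad (u - z)|],
    hence [|grad r| <= d / beta * |grad (u - z)|]. *)
Lemma div_free_quasi_optimal (Xh : set (@vjet R d)) (Qh : set ('rV[R]_d -> R))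
    (beta : R) (u z : @vjet R d) :
  Xh `<=` spaceX Omega -> finitely_spanned Xh ->
  Qh `<=` L20 Omega -> finitely_spanned Qh ->
  0 < beta -> inf_sup Omega Xh Qh beta ->
  spaceX Omega u -> {ae mu, forall x, Omega x -> divergence u x = 0} ->
  Xh z ->
  exists2 v, div_free Omega Xh Qh v &
    Defs.gnorm Omega (u - v) <= (1 + d%:R / beta) * Defs.gnorm Omega (u - z).
Proof.
move=> XX fX QL fQ beta0 infsup Xu divu Xz.
have XL v : Xh v -> L2_vjet Omega v by move=> /XX; exact: spaceX_L2_vjet.
have Lu : L2_vjet Omega u by exact: spaceX_L2_vjet.
have XS := finitely_spanned_subspace fX; have QS := finitely_spanned_subspace fQ.
have [DL _ gS g0] := G.
have divS := L2_divergence oO.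
have [m [b bE]] := fX; have [p [q qE]] := fQ.
have Xb i : Xh (b i).
  rewrite bE; exists (fun k => (k == i)%:R); rewrite (bigD1 i)//= eqxx scale1r.
  by rewrite big1 ?addr0// => k /negPf ->; rewrite scale0r.
have Qq j : Qh (q j).
  rewrite qE; exists (fun k => (k == j)%:R); rewrite (bigD1 j)//= eqxx scale1r.
  by rewrite big1 ?addr0// => k /negPf ->; rewrite scale0r.
have Lq j : L2 Omega (q j) by have [] := QL _ (Qq j).
have [c zE] : exists c : 'I_m -> R, z = \sum_i c i *: b i by move: Xz; rewrite bE.
have LdX v : Xh v -> L2 Omega (divergence v) by move=> /XL; exact: divS.
have div_sum (x : 'I_m -> R) h : L2 Omega h ->
    inner Omega (divergence (\sum_i x i *: b i)) h =
    \sum_i x i * inner Omega (divergence (b i)) h.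
  move=> Lh.
  rewrite divergence_lincomb (semi_inner_lincombl I)// => i; exact: LdX.
have [rc [y [gr rB]]] := discrete_lagrange
  (fun i j => inner Omega (divergence (b i)) (q j)) c G (fun i => XL _ (Xb i)).
pose r := \sum_i rc i *: b i; pose qs := \sum_j y j *: q j.
have Xr : Xh r by rewrite bE; exists rc.
have Qqs : Qh qs by rewrite qE; exists y.
have Lqs : L2 Omega qs by have [] := QL _ Qqs.
have gr' v : Xh v -> ginner Omega r v = inner Omega qs (divergence v).
  rewrite bE => -[x ->]; rewrite (semi_inner_lincombr G) => [|i|]; try exact: XL.
  have [_ _ -> _] := I; rewrite div_sum//; apply: eq_bigr => k _.
  by rewrite gr (semi_inner_lincombr I)//; exact: LdX.
have rz h : Qh h -> inner Omega (divergence r) h = inner Omega (divergence z) h.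
  rewrite qE => -[x ->]; rewrite !(semi_inner_lincombr I)//; try exact: LdX.
  by apply: eq_bigr => j _; rewrite zE !div_sum// rB.
exists (z - r).
  split => [|h Qsh]; first exact: linear_subspaceB.
  have -> : divergence (z - r) = divergence z - divergence r.
    by rewrite addrC -scaleN1r divergence_linear scaleN1r addrC.
  rewrite (semi_innerBl I) ?rz ?subrr//; try exact: LdX.
  by have [] := QL _ Qsh.
have grr : Defs.gnorm Omega r <= d%:R / beta * Defs.gnorm Omega (u - z).
  have Luz : L2_vjet Omega (u - z) by apply: (linear_subspaceB DL) => //; exact: XL.
  have r2 : Defs.gnorm Omega r ^+ 2 = ginner Omega r r by exact: sqr_sqrtr.
  have [r0|r_neq0] := eqVneq (Defs.gnorm Omega r) 0.
    by rewrite r0 !mulr_ge0 ?invr_ge0 ?sqrtr_ge0// ltW.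
  have r_gt0 : 0 < Defs.gnorm Omega r by rewrite lt_neqAle eq_sym r_neq0 sqrtr_ge0.
  have r2_le : Defs.gnorm Omega r ^+ 2 <=
      L2norm Omega qs * (d%:R * Defs.gnorm Omega (u - z)).
    have Ldz := LdX _ Xz; have Ldu : L2 Omega (divergence u) by exact: divS.
    have -> : Defs.gnorm Omega r ^+ 2 = - inner Omega qs (divergence (u - z)).
      have -> : divergence (u - z) = divergence u - divergence z.
        by rewrite addrC -scaleN1r divergence_linear scaleN1r addrC.
      rewrite (semi_innerBr I)// inner_ae_eq0// sub0r opprK r2 gr'//.
      by have [_ _ S _] := I; rewrite S rz// S.
    have Lnqs : L2 Omega (- qs).
      by rewrite -scaleN1r; exact: (linear_subspaceZ _ (L2_subspace mO)).
    rewrite -mulN1r -(semi_innerZl I)//; last exact: divS.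
    rewrite scaleN1r; apply: le_trans (cauchy_schwarz_sqrt I Lnqs (divS _ Luz)) _.
    rewrite (semi_innerNN I)// ler_wpM2l ?sqrtr_ge0//.
    exact: L2norm_divergence_le.
  have qs_neq0 : L2norm Omega qs != 0.
    apply/eqP => qs0; move: r2_le; rewrite qs0 mul0r.
    by rewrite leNgt exprn_gt0.
  have qs_gt0 : 0 < L2norm Omega qs by rewrite lt_neqAle eq_sym qs_neq0 sqrtr_ge0.
  have beta_le : beta <= Defs.gnorm Omega r / L2norm Omega qs.
    rewrite -lee_fin; apply: le_trans (le_trans infsup (ereal_inf_lbound _)) _.
      by exists qs.
    apply: ge_ereal_sup => _ [v [Xv v_neq0 ->]]; rewrite lee_fin -gr'//.
    have v_gt0 : 0 < Defs.gnorm Omega v by rewrite lt_neqAle eq_sym v_neq0 sqrtr_ge0.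
    rewrite ler_pdivrMr ?mulr_gt0// mulrA divfK//.
    by apply: (cauchy_schwarz_sqrt G); exact: XL.
  have qs_le : L2norm Omega qs <= Defs.gnorm Omega r / beta.
    by rewrite ler_pdivlMr// mulrC -ler_pdivlMr.
  rewrite -(ler_pM2l r_gt0) -expr2 (le_trans r2_le)//.
  have -> : Defs.gnorm Omega r * (d%:R / beta * Defs.gnorm Omega (u - z)) =
    Defs.gnorm Omega r / beta * (d%:R * Defs.gnorm Omega (u - z)) by ring.
  by rewrite ler_wpM2r// mulr_ge0 ?sqrtr_ge0.
have -> : u - (z - r) = (u - z) + r by rewrite opprB addrA addrAC.
apply: le_trans (semi_norm_triangle G _ (XL _ Xr)) _.
  by apply: (linear_subspaceB DL) => //; exact: XL.
by rewrite mulrDl mul1r lerD2l.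
Qed.

End discrete_spaces.

(** * The nudged step *)

(** Transfers an estimate valid for every candidate to the infimum of the
    approximation property, which need not be attained. *)
Lemma le_sqr_inf (R : realType) (S : set R) (M K s : R) :
  S !=set0 -> (forall r, S r -> 0 <= r) -> 0 <= M -> inf S <= K ->
  (forall r, S r -> s <= M * r ^+ 2) -> s <= M * K ^+ 2.
Proof.
move=> S0 Sge0 M0 SK sS; have [s0|s0] := leP s 0.
  by rewrite (le_trans s0)// mulr_ge0 ?sqr_ge0.
have M_gt0 : 0 < M.
  have [r Sr] := S0; rewrite lt_neqAle M0 andbT; apply/eqP => M00.
  by have := sS _ Sr; rewrite -M00 mul0r leNgt s0.
have : Num.sqrt (s / M) <= K.
  apply: le_trans SK; apply: lb_le_inf => // r Sr.
  rewrite -[leRHS]ger0_norm ?Sge0// -sqrtr_sqr ler_sqrt ?sqr_ge0//.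
  by rewrite ler_pdivrMr// mulrC sS.
move=> sK; rewrite -ler_pdivrMl// mulrC -[leLHS]sqr_sqrtr ?divr_ge0 ?(ltW s0)//.
by rewrite lerXn2r// nnegrE (sqrtr_ge0, le_trans (sqrtr_ge0 _) sK).
Qed.

Theorem theorem4p3 (R : realType) (d : nat) (d23 : d = 2%N \/ d = 3%N)
    (Omega : set 'rV[R]_d) (Omega_regular : regular_domain Omega)
    (k : nat) (Capprox : R) :
  exists2 C : R, 0 < C &
  forall
    (h : R) (Th : seq (@simplex R d))
    (Xh : set (@vjet R d)) (Qh : set ('rV[R]_d -> R)) (beta : R),
    triangulation Omega Th -> h = mesh_size Th ->
    velocity_space Omega Th Xh -> pressure_space Omega Th Qh ->
    0 < beta -> inf_sup Omega Xh Qh beta ->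
    approximation_property Omega k Capprox h Xh Qh ->
  forall CP : R, poincare_constant Omega CP ->
  forall (H chi Chat Cbreve : R) (IH : @vjet R d -> @vjet R d),
    0 < H -> 0 < chi -> observation_operator Omega Xh H Chat Cbreve IH ->
  forall (nu dt : R) (NT : nat), 0 < nu -> 0 < dt ->
  let T := NT%:R * dt in
  forall (f : R -> @field R d) (u : R -> @vjet R d) (p : R -> @jet R d),
    NSE_solution Omega nu T f u p -> Linfty_H Omega T k.+1 u ->
  forall n : nat, (n < NT)%N ->
  let t1 := n.+1%:R * dt in
  let Vh := div_free Omega Xh Qh in
  forall vn wn vn1 wn1 : @vjet R d, Vh vn -> Vh wn -> Vh vn1 -> Vh wn1 ->
    (forall phi, Vh phi ->
       vinner Omega (dt^-1 *: (vn1 - vn)) phi + bstar Omega vn vn phi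
       + chi * vinner Omega (IH (vn1 - u t1)) (IH phi)
       + nu * ginner Omega vn1 phi = finner Omega (f t1) (vval phi)) ->
    (forall phi, Vh phi ->
       vinner Omega (dt^-1 *: (wn1 - wn)) phi + bstar Omega wn wn phi
       + nu * ginner Omega wn1 phi = finner Omega (f t1) (vval phi)) ->
    vn = wn ->
    triple_norm Omega nu dt (vn1 - u t1) ^+ 2
    <= triple_norm Omega nu dt (wn1 - u t1) ^+ 2
       + C * dt * chi * Cbreve ^+ 2 * (CP ^+ 2 + dt * nu)
         * (1 + 1 / beta) ^+ 2 * h ^+ (2 * k)
         * sup_hnorm Omega T k.+1 u ^+ 2.
Proof.
have [_ oO _ bO _] := Omega_regular.
have d1 : 1 <= d%:R :> R by case: d23 => ->; rewrite ler1n.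
(* (1 + d / beta)^2 <= d^2 (1 + 1 / beta)^2, and the added 1 keeps C positive
   when Capprox = 0 *)
exists (d%:R ^+ 2 * Capprox ^+ 2 + 1).
  by rewrite ltr_wpDl// mulr_ge0 ?sqr_ge0.
move=> h Th Xh Qh beta _ _ [XX fX _] [QL fQ _] beta0 infsup [approx _].
move=> CP poincare H chi Chat Cbreve IH _ chi0 [IHX IHL _ IHs].
move=> nu dt NT nu0 dt0 T f u p [ut NSE] [sobu ubu] n nNT t1 Vh.
move=> vn wn vn1 wn1 Vvn Vwn Vv Vw stepv stepw vwn.
have t1T : t1 \in `[0, T].
  rewrite in_itv /= mulr_ge0 ?ler0n ?(ltW dt0)//=.
  by rewrite ler_wpM2r ?(ltW dt0)// ler_nat.
have [[Xu _] _ _ _ NSEae] := NSE _ t1T.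
have divu : {ae lebesgue_rV d, forall x, Omega x -> divergence (u t1) x = 0}.
  by apply: filterS NSEae => x NSEx /NSEx[].
have XS := finitely_spanned_subspace fX.
have VX : Vh `<=` Xh by move=> v [].
have VSX : Vh `<=` spaceX Omega by move=> v /VX /XX.
have SX := spaceX_subspace oO bO.
have SXL := @spaceX_L2_vjet R d Omega.
have onX b : semi_inner (L2_vjet Omega) b -> semi_inner (spaceX Omega) b.
  exact: (semi_inner_pullback (phi := id)).
have mP := onX _ (vinner_semi_inner oO).
have gP := onX _ (ginner_semi_inner oO).
have IP := inner_semi_inner (open_measurable_rV oO).
have LV v : Xh v -> L2 Omega (divergence v).
  by move=> /XX /SXL; exact: L2_divergence.
have VS : linear_subspace Vh.
  split => [|c v w [Xv dv] [Xw dw]].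
    split => [|q /QL[Lq _]]; first by case: XS.
    by rewrite divergence0 (semi_inner0l IP).
  split => [|q Qq]; first exact: XS.2.
  have [_ bL _ _] := IP; rewrite divergence_linear bL ?dv ?dw ?mulr0 ?addr0//.
  - exact: LV.
  - exact: LV.
  - by have [] := QL _ Qq.
have m0 x : 0 <= vinner Omega x x by case: mP.
have g0 x : 0 <= ginner Omega x x by case: gP.
have vnorm2 x : vnorm Omega x ^+ 2 = vinner Omega x x by exact: (sqr_sqrtr (m0 x)).
have gnorm2 x : Defs.gnorm Omega x ^+ 2 = ginner Omega x x by exact: (sqr_sqrtr (g0 x)).
have dtnu0 : 0 <= dt * nu by rewrite mulr_ge0 ?ltW.
pose a x y := vinner Omega x y + dt * nu * ginner Omega x y.
have aP : semi_inner (spaceX Omega) a by exact: semi_inner_addZ.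
pose s x y := vinner Omega (IH x) (IH y).
have sP : semi_inner (spaceX Omega) s.
  apply: (semi_inner_pullback (phi := IH)) mP => //.
  by move=> x Xx; apply: XX; exact: IHX.
have tripleE x : triple_norm Omega nu dt x ^+ 2 = a x x.
  rewrite /triple_norm sqr_sqrtr.
    by rewrite /a vnorm2 gnorm2.
  by rewrite vnorm2 gnorm2; exact: addr_ge0 (m0 x) (mulr_ge0 dtnu0 (g0 x)).
have sa x : spaceX Omega x -> s x x <= Cbreve ^+ 2 * a x x.
  move=> Xx; rewrite /s /a -vnorm2.
  apply: (@le_trans _ _ (Cbreve ^+ 2 * vinner Omega x x)).
    have IHx := IHs _ Xx; rewrite -vnorm2 -exprMn lerXn2r// ?nnegrE ?sqrtr_ge0//.
    by apply: le_trans IHx; exact: sqrtr_ge0.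
  by rewrite ler_wpM2l ?sqr_ge0// lerDl mulr_ge0.
have error_eq phi : Vh phi ->
    a (vn1 - wn1) phi + dt * chi * s (vn1 - u t1) phi = 0.
  (* the explicit convection terms agree because both steps start from wn *)
  move=> Vphi; have := stepw _ Vphi; rewrite -(stepv _ Vphi) vwn.
  have XV v : Vh v -> spaceX Omega v by exact: VSX.
  rewrite (semi_innerZl mP) ?(semi_innerZl mP); try by
    [exact: VSX | apply: (linear_subspaceB SX); exact: VSX].
  rewrite /a !(semi_innerBl mP) ?(semi_innerBl gP); try exact: VSX.
  rewrite /s.
  set X := vinner _ (IH _) _.
  set v1 := vinner _ vn1 _; set w1 := vinner _ wn1 _; set w0 := vinner _ wn _.
  set gv := ginner _ vn1 _; set gw := ginner _ wn1 _.
  move=> E.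
  have -> : v1 - w1 + dt * nu * (gv - gw) + dt * chi * X =
    dt * ((dt^-1 * (v1 - w0) + bstar Omega wn wn phi + chi * X + nu * gv) -
    (dt^-1 * (w1 - w0) + bstar Omega wn wn phi + nu * gw)).
    by field; rewrite gt_eqF.
  by rewrite E subrr mulr0.
have kappa0 : 0 <= dt * chi by rewrite mulr_ge0 ?ltW.
have a_poincare x : spaceX Omega x ->
    a x x <= (CP ^+ 2 + dt * nu) * Defs.gnorm Omega x ^+ 2.
  move=> /poincare Px; rewrite /a -gnorm2 -vnorm2 [leRHS]mulrDl lerD2r.
  rewrite -exprMn lerXn2r// ?nnegrE ?sqrtr_ge0//.
  by apply: le_trans Px; exact: sqrtr_ge0.
rewrite !tripleE.
pose D := a (vn1 - u t1) (vn1 - u t1) - a (wn1 - u t1) (wn1 - u t1).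
pose M := dt * chi / 2 * Cbreve ^+ 2 * (CP ^+ 2 + dt * nu) * (1 + d%:R / beta) ^+ 2.
have kL0 : 0 <= dt * chi / 2 * Cbreve ^+ 2.
  exact: mulr_ge0 (divr_ge0 kappa0 (ler0n R 2)) (sqr_ge0 _).
have cp0 : 0 <= CP ^+ 2 + dt * nu := addr_ge0 (sqr_ge0 CP) dtnu0.
have M0 : 0 <= M := mulr_ge0 (mulr_ge0 kL0 cp0) (sqr_ge0 _).
have DM : D <= M * (Capprox * h ^+ k * vhnorm Omega k.+1 (u t1)) ^+ 2.
  apply: le_sqr_inf (approx _ Xu (sobu _ t1T)) _ => //.
  - by exists (Defs.gnorm Omega (u t1 - 0)); exists 0 => //; case: XS.
  - by move=> _ [z _ ->]; exact: sqrtr_ge0.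
  move=> _ [z Xz ->].
  have [v Vv' zv] := div_free_quasi_optimal oO XX fX QL fQ beta0 infsup Xu divu Xz.
  have := nudging_estimate aP sP kappa0 (sqr_ge0 Cbreve) sa VS VSX Xu Vv Vw Vv' error_eq.
  rewrite -lerBlDl -/D => /le_trans; apply.
  rewrite /M -[leRHS]mulrA -[leRHS]mulrA; apply: ler_wpM2l => //.
  have Xuv : spaceX Omega (u t1 - v) by apply: (linear_subspaceB SX) => //; exact: VSX.
  apply: le_trans (a_poincare _ Xuv) _.
  rewrite ler_wpM2l// -exprMn lerXn2r// nnegrE ?sqrtr_ge0//.
  by apply: le_trans zv; exact: sqrtr_ge0.
rewrite -lerBlDl -/D (le_trans DM)//.
have u_sup : vhnorm Omega k.+1 (u t1) <= sup_hnorm Omega T k.+1 u.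
  by apply: ub_le_sup => //; exists t1.
have u_sup2 : vhnorm Omega k.+1 (u t1) ^+ 2 <= sup_hnorm Omega T k.+1 u ^+ 2.
  by rewrite lerXn2r// nnegrE ?(le_trans _ u_sup) ?sqrtr_ge0.
have beta_d : (1 + d%:R / beta) ^+ 2 <= d%:R ^+ 2 * (1 + 1 / beta) ^+ 2.
  have b0 : 0 <= beta^-1 by rewrite invr_ge0 ltW.
  rewrite -exprMn lerXn2r ?nnegrE ?mulr_ge0 ?addr_ge0 ?mulr_ge0//.
  by rewrite mulrDr mulr1 mul1r lerD2r.
pose P := dt * chi * Cbreve ^+ 2 * (CP ^+ 2 + dt * nu).
have P0 : 0 <= P := mulr_ge0 (mulr_ge0 kappa0 (sqr_ge0 _)) cp0.
pose h2 := (h ^+ k) ^+ 2.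
have -> : M * (Capprox * h ^+ k * vhnorm Omega k.+1 (u t1)) ^+ 2 =
  P * h2 * (Capprox ^+ 2 / 2 * ((1 + d%:R / beta) ^+ 2 * vhnorm Omega k.+1 (u t1) ^+ 2)).
  by rewrite /M /P /h2; ring.
have -> : h ^+ (2 * k) = h2 by rewrite mulnC exprM.
set U := sup_hnorm _ _ _ _ in u_sup u_sup2 *.
set V := vhnorm _ _ _ in u_sup u_sup2 *.
rewrite [leRHS](_ : _ = P * h2 * ((d%:R ^+ 2 * Capprox ^+ 2 + 1) *
  ((1 + 1 / beta) ^+ 2 * U ^+ 2))); last by rewrite /P; ring.
apply: ler_wpM2l; first exact: mulr_ge0 P0 (sqr_ge0 _).
apply: (@le_trans _ _ (Capprox ^+ 2 * (d%:R ^+ 2 * (1 + 1 / beta) ^+ 2 * U ^+ 2))).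
  have C2 : 0 <= Capprox ^+ 2 := sqr_ge0 _.
  apply: ler_pM; [by lra | exact: mulr_ge0 (sqr_ge0 _) (sqr_ge0 _) | by lra |].
  exact: ler_pM (sqr_ge0 _) (sqr_ge0 _) beta_d u_sup2.
rewrite [leRHS](_ : _ = Capprox ^+ 2 * (d%:R ^+ 2 * (1 + 1 / beta) ^+ 2 * U ^+ 2) +
  (1 + 1 / beta) ^+ 2 * U ^+ 2); last by ring.
by rewrite lerDl; exact: mulr_ge0 (sqr_ge0 _) (sqr_ge0 _).
Qed.
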